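(* Let $ABC$ be a triangle with circumcircle $\Omega$, let $P$ be a point with isogonal conjugate $P'$ with respect to $ABC$, and let $D$ be the intersection of $\Omega$ with the conic $(ABCPP')$ other than $A,B,C$. Let $X$ be the second intersection of line $DP$ with $\Omega$ and $Y$ the second intersection of line $DP'$ with $\Omega$. Let the circle $(PXY)$ meet line $PP'$ again at $Z$. (a) The circle $(PXY)$ and the conic $(ABCPZ)$ are tangent at $P$ and at $Z$. (b) Let the circle $(PXY)$ meet the conic $(ABCPX)$ at the points $Z_1, Z_2$ (other than $P, X$). Let lines $XZ_1, XZ_2$ meet $\Omega$ again at $Z_1', Z_2'$ respectively. Then line $Z_1'Z_2'$ is tangent to the conic $(ABCPP')$ at $P'$.
   Context: For points $X,Y,Z$, $(XYZ)$ denotes the circle through them; for five points $V,W,X,Y,Z$, $(VWXYZ)$ denotes the conic through them. *)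

(* Defs.v *)
From HB Require Import structures.
From mathcomp Require Import all_boot all_order all_algebra.
Set Implicit Arguments. Unset Strict Implicit. Unset Printing Implicit Defensive.
Import Order.TTheory GRing.Theory Num.Theory.
Local Open Scope ring_scope.

Section Geom.
Variable R : realFieldType.
Notation pt := (R * R)%type.

Definition vsub (u v : pt) : pt := (u.1 - v.1, u.2 - v.2).
Definition cross (u v : pt) : R := u.1 * v.2 - u.2 * v.1.
Definition dot (u v : pt) : R := u.1 * v.1 + u.2 * v.2.
(* complex multiplication of plane vectors: arguments (angles) add *)
Definition cmul (u v : pt) : pt := (u.1 * v.1 - u.2 * v.2, u.1 * v.2 + u.2 * v.1).

Definition collinear (A B C : pt) : Prop := cross (vsub B A) (vsub C A) = 0.

(* The lines AP and AQ are isogonal with respect to the angle BAC, i.e. AQ is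
   the reflection of AP in the bisector of angle A: as directed angles mod pi,
   angle(AB, AP) = angle(AQ, AC), i.e. arg(P-A) + arg(Q-A) = arg(B-A) + arg(C-A)
   (mod pi). *)
Definition isogonal_at (A B C P Q : pt) : Prop :=
  cross (cmul (vsub P A) (vsub Q A)) (cmul (vsub B A) (vsub C A)) = 0.

Definition isogonal_conjugate (A B C P Q : pt) : Prop :=
  [/\ isogonal_at A B C P Q, isogonal_at B C A P Q & isogonal_at C A B P Q].

Record conic := Conic { ca : R; cb : R; cc : R; cd : R; ce : R; cf : R }.

Definition ceval (K : conic) (p : pt) : R :=
  ca K * p.1 ^+ 2 + cb K * p.1 * p.2 + cc K * p.2 ^+ 2
  + cd K * p.1 + ce K * p.2 + cf K.

Definition on_conic (K : conic) (p : pt) : Prop := ceval K p = 0.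

Definition nonzero_conic (K : conic) : Prop :=
  ~ ([/\ ca K = 0, cb K = 0 & cc K = 0] /\ [/\ cd K = 0, ce K = 0 & cf K = 0]).

Definition is_circle (K : conic) : Prop := [/\ ca K = 1, cb K = 0 & cc K = 1].

Definition cgrad (K : conic) (p : pt) : pt :=
  (2 * ca K * p.1 + cb K * p.2 + cd K, cb K * p.1 + 2 * cc K * p.2 + ce K).

Definition tangent_at (K1 K2 : conic) (p : pt) : Prop :=
  [/\ on_conic K1 p, on_conic K2 p, cgrad K1 p != (0, 0), cgrad K2 p != (0, 0)
    & cross (cgrad K1 p) (cgrad K2 p) = 0].

Definition line_tangent_at (U V : pt) (K : conic) (p : pt) : Prop :=
  [/\ U <> V, collinear U V p, on_conic K p, cgrad K p != (0, 0)
    & dot (cgrad K p) (vsub V U) = 0].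

End Geom.

(* Main.v *)
(* Use complex coordinates with D = 0 and Om the circle |z|^2 = Re z, so that
   t |-> 1 / (1 - i t) parametrises Om minus D by the slope of the line through
   D. Write A = 1 / (1 - i a) and so on, and S = (1 - i a) (1 - i b) (1 - i c).
   Then P and P' are isogonal conjugates iff Re (S P P') = 1 and
   Im (S (P P' - P - P')) = a + b + c, and D lies on the conic K iff line PP' is
   Im (S z) = tau for some tau. Solving these equations leaves four free
   parameters k, u, v, th, in terms of which everything is rational. Moreover
   Im (S A) = a - (a + b + c), so that A, B, C are visibly on the members
   (Im (S z) - tau)^2 + c W of the pencil of W and the doubled line PP', which
   gives (a), and (line XP) (Im (S z) - q + a + b + c) + c' W of the pencil of W
   and the pair of line XP and a parallel to PP', for suitable constants c, c',
   where q is the slope of DP'.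
   In (b) the points Z1 and Z2 therefore lie on that parallel; projecting it from
   X back to Om gives a quadratic equation for the slopes of DZ1' and DZ2', whose
   roots are the slopes of the lines from D to the intersections of Om with the
   tangent to K at P'. *)
Require Import Defs.
From HB Require Import structures.
From mathcomp Require Import all_boot all_order all_algebra.
From mathcomp Require Import ring lra.
Set Implicit Arguments. Unset Strict Implicit. Unset Printing Implicit Defensive.
Import Order.TTheory GRing.Theory Num.Theory.
Local Open Scope ring_scope.

(** * Conics through the vertices of a triangle *)

Section Geometry.
Variable R : realFieldType.
Implicit Types (A B C P Q X Y Z : R * R) (K W : conic R).

Lemma add1sqr_gt0 (t : R) : 0 < 1 + t ^+ 2.
Proof. by rewrite ltr_wpDr ?sqr_ge0. Qed.

Lemma add1sqr_neq0 (t : R) : 1 + t ^+ 2 != 0.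
Proof. by rewrite gt_eqF ?add1sqr_gt0. Qed.

Lemma ceval0_coef K : (forall z, ceval K z = 0) ->
  [/\ ca K = 0, cb K = 0 & cc K = 0] /\ [/\ cd K = 0, ce K = 0 & cf K = 0].
Proof.
move=> h.
(* These six points lie on no common conic. *)
have := (h (0, 0), h (1, 0), h (-1, 0), h (0, 1), h (0, -1), h (1, 1)).
by rewrite /ceval /= => -[[[[[h1 h2] h3] h4] h5] h6]; split; split; lra.
Qed.

(** Twice the symmetric bilinear form of the homogenised conic: on the diagonal it is
    [2 * ceval K P]. *)
Definition cpolar K P Q : R :=
  2 * ca K * P.1 * Q.1 + cb K * (P.1 * Q.2 + P.2 * Q.1) + 2 * cc K * P.2 * Q.2
  + cd K * (P.1 + Q.1) + ce K * (P.2 + Q.2) + 2 * cf K.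

Definition area P Q Z : R := cross (vsub Q P) (vsub Z P).

(** In homogeneous coordinates [area A B C] times Z is the combination of A, B, C with weights
    [area Z B C], [area Z C A], [area Z A B]; the identity expands the quadratic form on it. *)
Lemma ceval_barycentric K A B C Z :
  area A B C ^+ 2 * ceval K Z =
  ceval K A * area Z B C ^+ 2 + ceval K B * area Z C A ^+ 2
  + ceval K C * area Z A B ^+ 2
  + cpolar K B C * (area Z C A * area Z A B)
  + cpolar K C A * (area Z A B * area Z B C)
  + cpolar K A B * (area Z B C * area Z C A).
Proof. rewrite /area /ceval /cpolar /cross /vsub /=. ring. Qed.

(** The vectors orthogonal to two independent vectors form a line, spanned by their cross product.
    Here the first coordinate of that product is nonzero, so u determines v and w; the other cases
    follow by rotating coordinates. *)
Lemma orthogonal_pair_proportional_aux (x y z x' y' z' u v w u' v' w' : R) :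
  y * z' - z * y' != 0 ->
  u * x + v * y + w * z = 0 -> u * x' + v * y' + w * z' = 0 ->
  u' * x + v' * y + w' * z = 0 -> u' * x' + v' * y' + w' * z' = 0 ->
  ~ (u' = 0 /\ v' = 0 /\ w' = 0) ->
  exists l, [/\ u = l * u', v = l * v' & w = l * w'].
Proof.
set n := y * z' - z * y' => n0 e1 e2 e3 e4 nz.
have ortho a b c : a * x + b * y + c * z = 0 -> a * x' + b * y' + c * z' = 0 ->
    b = a * (z * x' - x * z') / n /\ c = a * (x * y' - y * x') / n.
  move=> h1 h2; split; apply: (canRL (mulfK n0)); rewrite /n.
    have -> : b * (y * z' - z * y') = (b * y) * z' - (b * y') * z by ring.
    have -> : b * y = - a * x - c * z by lra.
    have -> : b * y' = - a * x' - c * z' by lra.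
    by ring.
  have -> : c * (y * z' - z * y') = (c * z') * y - (c * z) * y' by ring.
  have -> : c * z = - a * x - b * y by lra.
  have -> : c * z' = - a * x' - b * y' by lra.
  by ring.
have [vE wE] := ortho _ _ _ e1 e2; have [vE' wE'] := ortho _ _ _ e3 e4.
have u'0 : u' != 0.
  by apply/eqP => u'0; apply: nz; rewrite vE' wE' u'0 !mul0r.
by exists (u / u'); split; rewrite ?vE ?wE ?vE' ?wE'; field; rewrite ?u'0 ?n0.
Qed.

Lemma orthogonal_pair_proportional (x y z x' y' z' u v w u' v' w' : R) :
  [|| y * z' - z * y' != 0, z * x' - x * z' != 0 | x * y' - y * x' != 0] ->
  u * x + v * y + w * z = 0 -> u * x' + v * y' + w * z' = 0 ->
  u' * x + v' * y + w' * z = 0 -> u' * x' + v' * y' + w' * z' = 0 ->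
  ~ (u' = 0 /\ v' = 0 /\ w' = 0) ->
  exists l, [/\ u = l * u', v = l * v' & w = l * w'].
Proof.
have rot (a b c : R) : a + b + c = b + c + a by ring.
move=> /or3P[] n0 e1 e2 e3 e4 nz.
- exact: (orthogonal_pair_proportional_aux n0 e1 e2 e3 e4).
- have nz' : ~ (v' = 0 /\ w' = 0 /\ u' = 0) by tauto.
  rewrite rot in e1; rewrite rot in e2; rewrite rot in e3; rewrite rot in e4.
  by have [l []] := orthogonal_pair_proportional_aux n0 e1 e2 e3 e4 nz'; exists l.
- have nz' : ~ (w' = 0 /\ u' = 0 /\ v' = 0) by tauto.
  rewrite -rot in e1; rewrite -rot in e2; rewrite -rot in e3; rewrite -rot in e4.
  by have [l []] := orthogonal_pair_proportional_aux n0 e1 e2 e3 e4 nz'; exists l.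
Qed.

(* Injectivity of (a : b : c) |-> (bc : ca : ab) off the vertices of the triangle,
   with non-proportionality stated as a nonzero cross product. *)
Lemma cremona_inj (a b c a' b' c' : R) :
  a != 0 -> b != 0 -> c != 0 -> a + b + c != 0 -> a' + b' + c' = a + b + c ->
  ~~ [|| c * a * (a' * b') - a * b * (c' * a') != 0,
         a * b * (b' * c') - b * c * (a' * b') != 0
       | b * c * (c' * a') - c * a * (b' * c') != 0] ->
  [\/ b' = 0 /\ c' = 0, c' = 0 /\ a' = 0, a' = 0 /\ b' = 0 | a' = a /\ b' = b].
Proof.
move=> a0 b0 c0 s0 es; rewrite !negb_or !negbK => /and3P[/eqP e1 /eqP e2 /eqP e3].
have f1 : a * a' * (c * b' - b * c') = 0 by lra.
have f2 : b * b' * (a * c' - c * a') = 0 by lra.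
have f3 : c * c' * (b * a' - a * b') = 0 by lra.
move/eqP: f1; rewrite !mulf_eq0 (negPf a0) /= subr_eq0 => /orP f1.
move/eqP: f2; rewrite !mulf_eq0 (negPf b0) /= subr_eq0 => /orP f2.
move/eqP: f3; rewrite !mulf_eq0 (negPf c0) /= subr_eq0 => /orP f3.
have [a'0|a'0] := eqVneq a' 0.
  have [b'0|b'0] := eqVneq b' 0; first exact: Or43.
  case: f2 => [/eqP e|]; first by rewrite e eqxx in b'0.
  rewrite a'0 mulr0 mulf_eq0 (negPf a0) /= => /eqP c'0; exact: Or42.
case: f1 => [/eqP e|/eqP f1]; first by rewrite e eqxx in a'0.
have [b'0|b'0] := eqVneq b' 0.
  move/eqP: f1; rewrite b'0 mulr0 eq_sym mulf_eq0 (negPf b0) /= => /eqP c'0.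
  exact: Or41.
case: f2 => [/eqP e|/eqP f2]; first by rewrite e eqxx in b'0.
have [c'0|c'0] := eqVneq c' 0.
  by move/eqP: f1; rewrite c'0 mulr0 mulf_eq0 (negPf c0) (negPf b'0).
case: f3 => [/eqP e|/eqP f3]; first by rewrite e eqxx in c'0.
(* From a' b = a b' and a' c = a c' follows a' (a + b + c) = a (a' + b' + c'), and the two sums
   agree. *)
have g1 : a' = a.
  apply: (mulIf s0); rewrite -{2}es.
  lra.
by apply: Or44; split=> //; apply: (mulfI a0); rewrite -f3 g1 mulrC.
Qed.

(* A conic through A, B, C is, in barycentric coordinates (a, b, c), a combination
   of bc, ca and ab, so passing through a further point is a linear condition
   given by the image of that point under the Cremona map above. *)
Lemma conic_proportional A B C P Z K K' :
  ~ collinear A B C -> ~ collinear P B C -> ~ collinear P C A ->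
  ~ collinear P A B -> Z <> A -> Z <> B -> Z <> C -> Z <> P ->
  nonzero_conic K' ->
  on_conic K A -> on_conic K B -> on_conic K C -> on_conic K P ->
  on_conic K Z ->
  on_conic K' A -> on_conic K' B -> on_conic K' C -> on_conic K' P ->
  on_conic K' Z ->
  exists l, forall z, ceval K z = l * ceval K' z.
Proof.
rewrite /on_conic => /eqP nABC /eqP aP /eqP bP /eqP cP ZA ZB ZC ZP K'0.
move=> KA KB KC KP KZ K'A K'B K'C K'P K'Z.
have D0 : area A B C != 0 by [].
have bary (H : conic R) : ceval H A = 0 -> ceval H B = 0 -> ceval H C = 0 ->
    forall z, ceval H z = (cpolar H B C * (area z C A * area z A B)
  + cpolar H C A * (area z A B * area z B C)
  + cpolar H A B * (area z B C * area z C A)) / area A B C ^+ 2.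
  move=> h1 h2 h3 z; apply: (canRL (mulfK _)); first by rewrite sqrf_eq0.
  by rewrite mulrC ceval_barycentric h1 h2 h3; ring.
have area_sum z : area z B C + area z C A + area z A B = area A B C.
  by rewrite /area /cross /vsub /=; ring.
have area_inj z1 z2 : area z1 B C = area z2 B C -> area z1 C A = area z2 C A ->
    z1 = z2.
  case: z1 z2 => [x1 y1] [x2 y2]; move: D0; rewrite /area /cross /vsub /= => D0 e1 e2.
  congr (_, _); apply/eqP; rewrite -subr_eq0; apply/eqP; apply: (mulIf D0);
    rewrite mul0r.
    have f1 := congr1 (fun t => t * (C.1 - A.1)) e1.
    have f2 := congr1 (fun t => t * (C.1 - B.1)) e2.
    by move: f1 f2 => /= f1 f2; lra.
  have f1 := congr1 (fun t => t * (C.2 - A.2)) e1.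
  have f2 := congr1 (fun t => t * (C.2 - B.2)) e2.
  by move: f1 f2 => /= f1 f2; lra.
have K'pol : ~ (cpolar K' B C = 0 /\ cpolar K' C A = 0 /\ cpolar K' A B = 0).
  move=> [h1 [h2 h3]]; apply/K'0/ceval0_coef => z.
  by rewrite (bary K') // h1 h2 h3; ring.
have barycentric_eq (H : conic R) z : ceval H A = 0 -> ceval H B = 0 -> ceval H C = 0 ->
    ceval H z = 0 -> cpolar H B C * (area z C A * area z A B)
  + cpolar H C A * (area z A B * area z B C)
  + cpolar H A B * (area z B C * area z C A) = 0.
  move=> hA hB hC; rewrite (bary H) // => /eqP; rewrite mulf_eq0 invr_eq0 sqrf_eq0.
  by rewrite (negPf D0) orbF => /eqP.
have [|l [lu lv lw]] := orthogonal_pair_proportional _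
  (barycentric_eq K P KA KB KC KP) (barycentric_eq K Z KA KB KC KZ)
  (barycentric_eq K' P K'A K'B K'C K'P) (barycentric_eq K' Z K'A K'B K'C K'Z) K'pol;
  last first.
  by exists l => z; rewrite (bary K) // (bary K' _ _ _ z) // lu lv lw; ring.
have verts : [/\ area A C A = 0, area A A B = 0 & area B B C = 0] /\
    [/\ area B A B = 0, area C B C = 0 & area C C A = 0].
  by split; split; rewrite /area /cross /vsub /=; ring.
have [[A1 A2 B1] [B2 C1 C2]] := verts.
(* If the Cremona images of P and Z were proportional, Z would be a vertex or P. *)
apply/negPn/negP => /(cremona_inj aP bP cP) []; rewrite ?area_sum //.
- move=> [h1 h2]; apply/ZA/area_inj; last by rewrite h1 A1.
  by have := area_sum Z; have := area_sum A; rewrite h1 h2 A1 A2; lra.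
- move=> [h1 h2]; apply/ZB/area_inj; first by rewrite h2 B1.
  by have := area_sum Z; have := area_sum B; rewrite h1 h2 B1 B2; lra.
- by move=> [h1 h2]; apply/ZC/area_inj; rewrite ?h1 ?h2.
- by move=> [h1 h2]; apply/ZP/area_inj.
Qed.

Lemma cgrad_scale K K' l : (forall z, ceval K z = l * ceval K' z) ->
  forall z, cgrad K z = (l * (cgrad K' z).1, l * (cgrad K' z).2).
Proof.
case: K K' => [a b c d e f] [a' b' c' d' e' f'] h [x y].
have := @ceval0_coef (Conic (a - l * a') (b - l * b') (c - l * c')
  (d - l * d') (e - l * e') (f - l * f')).
case=> [z|/= [h1 h2 h3] [h4 h5 h6]].
  by have := h z; rewrite /ceval /= => hz; lra.
rewrite /cgrad /=.
have -> : a = l * a' by lra. have -> : b = l * b' by lra.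
have -> : c = l * c' by lra. have -> : d = l * d' by lra.
have -> : e = l * e' by lra.
by congr (_, _); ring.
Qed.

(** The gradient vanishes only at the centre, and a circle containing its own centre has no other
    point. *)
Lemma circle_cgrad_neq0 W P Q :
  is_circle W -> on_conic W P -> on_conic W Q -> P <> Q -> cgrad W P != (0, 0).
Proof.
case: W P Q => [a b c d e f] [x y] [x' y'] [/= -> -> ->].
rewrite /on_conic /ceval /= => hP hQ PQ; apply/eqP; rewrite /cgrad /= => -[g1 g2].
have : (x - x') ^+ 2 + (y - y') ^+ 2 = 0.
  have dE : d = - 2 * x by lra.
  have eE : e = - 2 * y by lra.
  by rewrite dE eE in hP hQ; lra.
move/eqP; rewrite paddr_eq0 ?sqr_ge0 // !sqrf_eq0 !subr_eq0.
by move=> /andP[/eqP ex /eqP ey]; apply: PQ; rewrite ex ey.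
Qed.

Lemma cross_eq0_orthogonal (n a b : R * R) :
  n != (0, 0) -> dot n a = 0 -> dot n b = 0 -> cross a b = 0.
Proof.
case: n a b => [n1 n2] [a1 a2] [b1 b2]; rewrite /dot /cross /= xpair_eqE.
rewrite negb_and => /orP[] n0 h1 h2; apply: (mulfI n0); rewrite mulr0.
  have -> : n1 * (a1 * b2 - a2 * b1) = (n1 * a1) * b2 - a2 * (n1 * b1) by ring.
  have -> : n1 * a1 = - (n2 * a2) by lra.
  have -> : n1 * b1 = - (n2 * b2) by lra.
  ring.
have -> : n2 * (a1 * b2 - a2 * b1) = a1 * (n2 * b2) - (n2 * a2) * b1 by ring.
have -> : n2 * a2 = - (n1 * a1) by lra.
have -> : n2 * b2 = - (n1 * b1) by lra.
ring.
Qed.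

Lemma tangent_at_scale W K P r :
  on_conic W P -> on_conic K P -> cgrad W P != (0, 0) -> r != 0 ->
  cgrad K P = (r * (cgrad W P).1, r * (cgrad W P).2) -> tangent_at W K P.
Proof.
rewrite /tangent_at => hW hK; case: (cgrad W P) (cgrad K P) => [x y] [x' y'].
move=> /= W0 r0 [-> ->].
split=> //; last by rewrite /cross /=; ring.
by move: W0; rewrite !xpair_eqE !mulf_eq0 (negPf r0).
Qed.

End Geometry.

(** * The configuration in normal form *)

Section Normalized.
Variable R : realFieldType.
Implicit Types (A B C P Q X Y Z : R * R) (K W : conic R).

(* In complex notation, [ray_pt m t] is 1 / (m (1 - i t)). *)
Definition ray_pt (m t : R) : R * R :=
  (1 / (m * (1 + t ^+ 2)), t / (m * (1 + t ^+ 2))).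

Definition std_circle : conic R := Conic 1 0 1 (- 1) 0 0.

Lemma std_circleP Z :
  on_conic std_circle Z -> Z <> (0, 0) -> exists t, Z = ray_pt 1 t.
Proof.
case: Z => x y; rewrite /on_conic /ceval /= => e nz.
have x0 : x != 0.
  apply/eqP => x0; apply: nz; rewrite x0; congr (_, _).
  by apply/eqP; rewrite -sqrf_eq0; apply/eqP; rewrite x0 in e; lra.
have n0 := add1sqr_neq0 (y / x).
have xE : x = 1 / (1 * (1 + (y / x) ^+ 2)).
  rewrite [1 * (_ + _)]mul1r; apply: (canRL (mulfK n0)).
  have -> : x * (1 + (y / x) ^+ 2) = (x ^+ 2 + y ^+ 2) / x by field.
  have -> : x ^+ 2 + y ^+ 2 = x by lra.
  by rewrite divff.
exists (y / x); congr (_, _) => //.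
by rewrite -[LHS](divfK x0) {2}xE mulrA mulr1.
Qed.

(** [Q] stands for P'. The slopes of DP and DP' are p and q, and k is Im (S P P'). That D lies on K
    amounts to mu (k - p) = nu (k - q); setting u = k - p, v = k - q, mu = th v, nu = th u builds
    this relation in. *)
Variables (k u v th : R).
Hypotheses (u0 : u != 0) (v0 : v != 0) (th0 : th != 0).

(* In complex notation, with S = (1 - i a) (1 - i b) (1 - i c) = nf_sx - i nf_sy,
   [nf_lin z] is Im (S z), the line PP' is [nf_lin z = nf_tau], and
   k - 2 nf_tau = a + b + c. *)
Let p := k - u.
Let q := k - v.
Let mu := th * v.
Let nu := th * u.
Definition nf_tau := th * u * v.
Definition nf_sx := mu * nu * (1 - p * q + k * (p + q)).
Definition nf_sy := mu * nu * (p + q - k * (1 - p * q)).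
Definition nf_lin Z := nf_sx * Z.2 - nf_sy * Z.1.
Definition nf_P := ray_pt mu p.
Definition nf_Q := ray_pt nu q.
Definition nf_X := ray_pt 1 p.
Definition nf_Y := ray_pt 1 q.
Definition nf_K : conic R := Conic (nf_tau + nf_sy) (- nf_sx) nf_tau (nf_tau - k) 1 0.
(** The circle (PXY), written as [std_circle] plus a multiple of the equation of line XY; the factor
    [nf_P.1] makes it pass through P. *)
Definition nf_W : conic R :=
  Conic 1 0 1 (- 1 + nf_P.1 * (p * q - 1)) (- nf_P.1 * (p + q)) nf_P.1.

Lemma nf_lin_P : nf_lin nf_P = nf_tau.
Proof.
rewrite /nf_lin /nf_P /nf_sx /nf_sy /nf_tau /ray_pt /= /mu /nu /q /p.
by field; rewrite v0 th0 add1sqr_neq0.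
Qed.

Lemma nf_lin_Q : nf_lin nf_Q = nf_tau.
Proof.
rewrite /nf_lin /nf_Q /nf_sx /nf_sy /nf_tau /ray_pt /= /mu /nu /q /p.
by field; rewrite u0 th0 add1sqr_neq0.
Qed.

Lemma nf_P_on_W : on_conic nf_W nf_P.
Proof.
rewrite /on_conic /ceval /nf_W /nf_P /ray_pt /= /mu /nu /q /p.
by field; rewrite v0 th0 add1sqr_neq0.
Qed.

Lemma nf_X_on_W : on_conic nf_W nf_X.
Proof.
rewrite /on_conic /ceval /nf_W /nf_P /nf_X /ray_pt /= /mu /nu /q /p.
by field; rewrite v0 th0 add1sqr_neq0.
Qed.

Lemma nf_Y_on_W : on_conic nf_W nf_Y.
Proof.
rewrite /on_conic /ceval /nf_W /nf_P /nf_Y /ray_pt /= /mu /nu /q /p.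
by field; rewrite v0 th0 !add1sqr_neq0.
Qed.

(** Clearing denominators turns the condition on t into a monic cubic, whose roots are the slopes of
    DA, DB and DC; the three vertices can thus be treated alike. *)
Definition nf_vertex Z :=
  exists t, Z = ray_pt 1 t /\ nf_lin Z = t - (k - 2 * nf_tau).

(* The conic (ABCPZ), as a member of the pencil spanned by the circle [nf_W] and
   the doubled line PP'. *)
Definition conicZ : conic R :=
  let c := - mu ^+ 2 * nu * (1 + k ^+ 2) * (1 + p ^+ 2) in
  Conic (nf_sy ^+ 2 + c) (- 2 * nf_sx * nf_sy) (nf_sx ^+ 2 + c)
    (2 * nf_sy * nf_tau + c * cd nf_W) (- 2 * nf_sx * nf_tau + c * ce nf_W)
    (nf_tau ^+ 2 + c * cf nf_W).

Lemma ceval_conicZ Z : ceval conicZ Z = (nf_lin Z - nf_tau) ^+ 2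
  - mu ^+ 2 * nu * (1 + k ^+ 2) * (1 + p ^+ 2) * ceval nf_W Z.
Proof. by rewrite /ceval /nf_lin /=; ring. Qed.

Lemma vertex_on_conicZ Z : nf_vertex Z -> on_conic conicZ Z.
Proof.
move=> [t [ZE]]; rewrite /on_conic ceval_conicZ => linZ.
have cubic : (t - (k - 2 * nf_tau)) * (1 + t ^+ 2) = nf_sx * t - nf_sy.
  rewrite -linZ ZE /nf_lin /=; field; exact: add1sqr_neq0.
rewrite linZ.
have -> : ceval nf_W Z = nf_P.1 * (t - p) * (t - q) / (1 + t ^+ 2).
  rewrite ZE /ceval /nf_W; move: nf_P.1 => r /=; field; exact: add1sqr_neq0.
have -> : mu ^+ 2 * nu * (1 + k ^+ 2) * (1 + p ^+ 2) *
   (nf_P.1 * (t - p) * (t - q) / (1 + t ^+ 2)) =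
   mu * nu * (1 + k ^+ 2) * (t - p) * (t - q) / (1 + t ^+ 2).
  rewrite /nf_P /= /mu; field; by rewrite v0 th0 !add1sqr_neq0.
apply: (mulIf (add1sqr_neq0 t)); rewrite mul0r mulrBl divfK ?add1sqr_neq0 //.
have : (t - k) * ((t - (k - 2 * nf_tau)) * (1 + t ^+ 2) - (nf_sx * t - nf_sy)) = 0.
  by rewrite cubic subrr mulr0.
move=> <-; rewrite /nf_sx /nf_sy /nf_tau /mu /nu /p /q; ring.
Qed.

Lemma mu_neq0 : mu != 0. Proof. by rewrite mulf_neq0. Qed.
Lemma nu_neq0 : nu != 0. Proof. by rewrite mulf_neq0. Qed.

(** In complex notation S = mu nu (1 - i p) (1 - i q) (1 + i k); take squared moduli. *)
Lemma nf_sxy_sqnorm :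
  nf_sx ^+ 2 + nf_sy ^+ 2 = (mu * nu) ^+ 2 * (1 + k ^+ 2) * (1 + p ^+ 2) * (1 + q ^+ 2).
Proof. by rewrite /nf_sx /nf_sy; ring. Qed.

Lemma nf_sxy_neq0 : ~ (nf_sx = 0 /\ nf_sy = 0).
Proof.
move=> [x0 y0].
have : nf_sx ^+ 2 + nf_sy ^+ 2 != 0.
  by rewrite nf_sxy_sqnorm !mulf_neq0 ?sqrf_eq0 ?mulf_neq0 ?mu_neq0 ?nu_neq0
    ?add1sqr_neq0.
by rewrite x0 y0 expr0n add0r eqxx.
Qed.

(** The square of a nonzero linear form is no multiple of x^2 + y^2. *)
Lemma conicZ_nonzero : nonzero_conic conicZ.
Proof.
move=> [[/= h1 h2 h3] _]; apply: nf_sxy_neq0.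
have e1 : nf_sx ^+ 2 - nf_sy ^+ 2 = 0 by lra.
have e2 : nf_sx * nf_sy = 0 by lra.
by move/eqP: e2; rewrite mulf_eq0 => /orP[]/eqP e; rewrite e expr0n /= in e1;
  move/eqP: e1; rewrite ?sub0r ?subr0 ?oppr_eq0 sqrf_eq0 => /eqP.
Qed.

(** On line PP' the squared term of [ceval_conicZ] has zero gradient, so only the multiple of [nf_W]
    contributes. *)
Lemma cgrad_conicZ Z : nf_lin Z = nf_tau ->
  let r := - (mu ^+ 2 * nu * (1 + k ^+ 2) * (1 + p ^+ 2)) in
  cgrad conicZ Z = (r * (cgrad nf_W Z).1, r * (cgrad nf_W Z).2).
Proof. by rewrite /cgrad /= => <-; rewrite /nf_lin; congr (_, _); ring. Qed.

Lemma circle_tangent_conicZ A B C K Z :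
  ~ collinear A B C -> nf_vertex A -> nf_vertex B -> nf_vertex C ->
  ~ collinear nf_P B C -> ~ collinear nf_P C A -> ~ collinear nf_P A B ->
  on_conic nf_W Z -> nf_lin Z = nf_tau -> Z <> nf_P -> Z <> A -> Z <> B -> Z <> C ->
  nonzero_conic K -> on_conic K A -> on_conic K B -> on_conic K C ->
  on_conic K nf_P -> on_conic K Z ->
  tangent_at nf_W K nf_P /\ tangent_at nf_W K Z.
Proof.
move=> nABC hA hB hC nA nB nC WZ lZ ZP ZA ZB ZC K0 KA KB KC KP KZ.
have on_conicZ z : on_conic nf_W z -> nf_lin z = nf_tau -> on_conic conicZ z.
  by rewrite /on_conic ceval_conicZ => -> ->; rewrite subrr expr0n mulr0 subr0.
have WP := nf_P_on_W; have lP := nf_lin_P.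
have [l lE] := conic_proportional nABC nA nB nC ZA ZB ZC ZP conicZ_nonzero
  KA KB KC KP KZ (vertex_on_conicZ hA) (vertex_on_conicZ hB)
  (vertex_on_conicZ hC) (on_conicZ _ WP lP) (on_conicZ _ WZ lZ).
have l0 : l != 0.
  by apply/eqP => l0; apply/K0/ceval0_coef => z; rewrite lE l0 mul0r.
have c0 : l * - (mu ^+ 2 * nu * (1 + k ^+ 2) * (1 + p ^+ 2)) != 0.
  by rewrite mulf_neq0 // oppr_eq0 !mulf_neq0 ?add1sqr_neq0 ?mu_neq0 ?nu_neq0.
have cW : is_circle nf_W by [].
by split; apply: (tangent_at_scale _ _ _ c0) => //;
  rewrite ?(circle_cgrad_neq0 cW WP WZ) ?(circle_cgrad_neq0 cW WZ WP) //;
  do ?[by apply: nesym]; rewrite (cgrad_scale lE) cgrad_conicZ //= !mulrA.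
Qed.

(* The conic (ABCPX), as a member of the pencil spanned by [nf_W] and the pair
   formed by line XP and the parallel [nf_lin z = q - (k - 2 * nf_tau)] to PP',
   which must therefore carry Z1 and Z2. *)
Definition conicX : conic R :=
  let c := mu * (1 + p ^+ 2) in
  let s := q - (k - 2 * nf_tau) in
  Conic (- p * nf_sy + c) (nf_sy + p * nf_sx) (- nf_sx + c)
    (- p * s + c * cd nf_W) (s + c * ce nf_W) (c * cf nf_W).

Lemma ceval_conicX Z : ceval conicX Z =
  (Z.2 - p * Z.1) * (q - (k - 2 * nf_tau) - nf_lin Z)
  + mu * (1 + p ^+ 2) * ceval nf_W Z.
Proof. by rewrite /ceval /nf_lin /=; ring. Qed.

(** At a vertex of slope t the two line factors are (t - p) / (1 + t^2) and q - t, while [nf_W]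
    takes the value [nf_P.1] (t - p) (t - q) / (1 + t^2); since [nf_P.1] is 1 / (mu (1 + p^2)), the
    terms cancel. *)
Lemma vertex_on_conicX Z : nf_vertex Z -> on_conic conicX Z.
Proof.
move=> [t [ZE linZ]]; rewrite /on_conic ceval_conicX linZ ZE /ceval /nf_W /= /mu /p.
by field; rewrite th0 v0 !add1sqr_neq0.
Qed.

Lemma conicX_nonzero : nonzero_conic conicX.
Proof.
move=> [[/= h1 h2 h3] _]; apply: nf_sxy_neq0.
have yE : nf_sy = - p * nf_sx by lra.
have /eqP : nf_sx * (1 + p ^+ 2) = 0 by move: h1; rewrite yE; lra.
rewrite mulf_eq0 (negPf (add1sqr_neq0 _)) orbF => /eqP x0.
by rewrite yE x0 mulr0.
Qed.

Lemma nf_W_secant Z : on_conic nf_W Z -> Z.2 = p * Z.1 -> Z = nf_P \/ Z = nf_X.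
Proof.
case: Z => x y /= hW yE.
have /eqP : (1 + p ^+ 2) * (x - nf_P.1) * (x - nf_X.1) = 0.
  rewrite -hW yE /ceval /= /mu /p; field; by rewrite th0 v0 !add1sqr_neq0.
rewrite !mulf_eq0 (negPf (add1sqr_neq0 _)) /= !subr_eq0 yE.
move=> /orP[]/eqP ->; [left|right]; rewrite /nf_P /nf_X /ray_pt /=;
  by congr (_, _); rewrite mulrA mulr1.
Qed.

Lemma nf_lin_on_conicX Z :
  on_conic nf_W Z -> on_conic conicX Z -> Z <> nf_P -> Z <> nf_X ->
  nf_lin Z = q - (k - 2 * nf_tau).
Proof.
move=> WZ; rewrite /on_conic ceval_conicX WZ mulr0 addr0 => /eqP.
rewrite mulf_eq0 !subr_eq0 => /orP[/eqP/(nf_W_secant WZ)[]//|/eqP //].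
Qed.

(** Write Z = X + r D, where [D] is now the vector from X to the point of Om with slope t. The
    circle determines r in terms of t, and eliminating r from the equation of the parallel leaves a
    quadratic in t. *)
Lemma second_intersection_quadratic Z t :
  on_conic nf_W Z -> nf_lin Z = q - (k - 2 * nf_tau) -> Z <> nf_X ->
  collinear nf_X Z (ray_pt 1 t) -> ray_pt 1 t <> nf_X ->
  mu * ((1 + t ^+ 2) * (q - (k - 2 * nf_tau)) - nf_sx * t + nf_sy)
  + (t - q) * (nf_sx - mu * nu * v * (t + p)) = 0.
Proof.
have p2 := add1sqr_neq0 p; have t2 := add1sqr_neq0 t.
set D := vsub (ray_pt 1 t) nf_X.
move=> WZ lZ ZX col tX.
have tp : t != p by apply/eqP => tp; apply: tX; rewrite tp.
have DE : D = ((p - t) * (p + t) / ((1 + t ^+ 2) * (1 + p ^+ 2)),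
    (t - p) * (1 - p * t) / ((1 + t ^+ 2) * (1 + p ^+ 2))).
  by rewrite /D /vsub /nf_X /ray_pt /=; congr (_, _); field; rewrite p2 t2.
have normD : D.1 ^+ 2 + D.2 ^+ 2 = (t - p) ^+ 2 / ((1 + t ^+ 2) * (1 + p ^+ 2)).
  by rewrite DE /=; field; rewrite p2 t2.
have normD0 : D.1 ^+ 2 + D.2 ^+ 2 != 0.
  rewrite normD; apply: mulf_neq0; first by rewrite expf_neq0 ?subr_eq0.
  by rewrite invr_eq0 mulf_neq0.
have [r [r1 r2]] : exists r, Z.1 - nf_X.1 = r * D.1 /\ Z.2 - nf_X.2 = r * D.2.
  exists (((Z.1 - nf_X.1) * D.1 + (Z.2 - nf_X.2) * D.2) / (D.1 ^+ 2 + D.2 ^+ 2)).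
  have {}col : (Z.1 - nf_X.1) * D.2 = (Z.2 - nf_X.2) * D.1.
    by apply/eqP; rewrite -subr_eq0; apply/eqP; exact: col.
  split; rewrite mulrAC; apply: (canRL (mulfK normD0)).
    have -> : ((Z.1 - nf_X.1) * D.1 + (Z.2 - nf_X.2) * D.2) * D.1 =
      (Z.1 - nf_X.1) * D.1 ^+ 2 + ((Z.2 - nf_X.2) * D.1) * D.2 by ring.
    by rewrite -col; ring.
  have -> : ((Z.1 - nf_X.1) * D.1 + (Z.2 - nf_X.2) * D.2) * D.2 =
    ((Z.1 - nf_X.1) * D.2) * D.1 + (Z.2 - nf_X.2) * D.2 ^+ 2 by ring.
  by rewrite col; ring.
have r0 : r != 0.
  apply/eqP => r0; apply: ZX; move: r1 r2; rewrite r0 !mul0r.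
  by case: (Z) (nf_X) => [x y] [x' y'] /= /subr0_eq -> /subr0_eq ->.
have powerD : mu * (t - p) * (1 - r) = t - q.
  have : ceval nf_W Z - ceval nf_W nf_X = 0 by rewrite WZ nf_X_on_W subrr.
  (* Along the chord the circle is a quadratic in r whose root 0 belongs to X; the other factor
     determines r. *)
  have -> : ceval nf_W Z - ceval nf_W nf_X = r * (r * (D.1 ^+ 2 + D.2 ^+ 2)
      + ((cgrad nf_W nf_X).1 * D.1 + (cgrad nf_W nf_X).2 * D.2)).
    have -> : Z = (nf_X.1 + r * D.1, nf_X.2 + r * D.2).
      by rewrite -r1 -r2 !subrKC; case: (Z).
    by rewrite /ceval /cgrad /=; ring.
  have -> : r * (D.1 ^+ 2 + D.2 ^+ 2)
      + ((cgrad nf_W nf_X).1 * D.1 + (cgrad nf_W nf_X).2 * D.2) =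
      ((t - q) - mu * (t - p) * (1 - r)) * (t - p)
      / (mu * (1 + p ^+ 2) * (1 + t ^+ 2)).
    rewrite normD DE /cgrad /nf_W /nf_P /nf_X /= /mu; field.
    by rewrite th0 v0 p2 t2.
  have n0 : mu * (1 + p ^+ 2) * (1 + t ^+ 2) != 0.
    by rewrite !mulf_neq0 ?mu_neq0.
  move/eqP; rewrite mulf_eq0 (negPf r0) /= mulf_eq0 invr_eq0 (negPf n0) orbF.
  by rewrite mulf_eq0 !subr_eq0 (negPf tp) orbF => /eqP ->.
have linD : (q - (k - 2 * nf_tau)) * (1 + t ^+ 2) =
    nf_sx * t - nf_sy - (1 - r) * (t - p) * (nf_sx - mu * nu * v * (t + p)).
  rewrite -lZ; have -> : Z = (nf_X.1 + r * D.1, nf_X.2 + r * D.2).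
    by rewrite -r1 -r2 !subrKC; case: (Z).
  rewrite DE /nf_lin /nf_X /nf_sx /nf_sy /= /mu /nu /p /q; field.
  by rewrite p2 t2.
rewrite [(1 + _) * _]mulrC linD -{1}powerD; ring.
Qed.

Lemma nf_Q_on_K : on_conic nf_K nf_Q.
Proof.
rewrite /on_conic /ceval /nf_K /nf_Q /nf_sx /nf_sy /nf_tau /= /mu /nu /q /p.
by field; rewrite u0 th0 add1sqr_neq0.
Qed.

Lemma chord_tangent_K A B C K Z1 Z2 Z1' Z2' :
  ~ collinear A B C -> nf_vertex A -> nf_vertex B -> nf_vertex C -> nu != 1 ->
  ~ collinear nf_P B C -> ~ collinear nf_P C A -> ~ collinear nf_P A B ->
  nf_X <> nf_P -> nf_X <> A -> nf_X <> B -> nf_X <> C ->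
  nonzero_conic K -> on_conic K A -> on_conic K B -> on_conic K C ->
  on_conic K nf_P -> on_conic K nf_X ->
  on_conic nf_W Z1 -> on_conic K Z1 -> Z1 <> nf_P -> Z1 <> nf_X ->
  on_conic nf_W Z2 -> on_conic K Z2 -> Z2 <> nf_P -> Z2 <> nf_X ->
  on_conic std_circle Z1' -> collinear nf_X Z1 Z1' -> Z1' <> nf_X ->
  on_conic std_circle Z2' -> collinear nf_X Z2 Z2' -> Z2' <> nf_X ->
  Z1' <> Z2' ->
  line_tangent_at Z1' Z2' nf_K nf_Q.
Proof.
move=> nABC hA hB hC nu1 nA nB nC XP XA XB XC K0 KA KB KC KP KX.
move=> WZ1 KZ1 Z1P Z1X WZ2 KZ2 Z2P Z2X OZ1 cZ1 Z1'X OZ2 cZ2 Z2'X Z12.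
have on_conicX z : on_conic nf_W z -> z.2 = p * z.1 -> on_conic conicX z.
  by rewrite /on_conic ceval_conicX => -> ->; rewrite subrr mul0r mulr0 addr0.
have lP : nf_P.2 = p * nf_P.1 by rewrite /nf_P /= mulrA mulr1.
have lX : nf_X.2 = p * nf_X.1 by rewrite /nf_X /= mulrA mulr1.
have [l lE] := conic_proportional nABC nA nB nC XA XB XC XP conicX_nonzero
  KA KB KC KP KX (vertex_on_conicX hA) (vertex_on_conicX hB)
  (vertex_on_conicX hC) (on_conicX _ nf_P_on_W lP) (on_conicX _ nf_X_on_W lX).
have l0 : l != 0.
  by apply/eqP => l0; apply/K0/ceval0_coef => z; rewrite lE l0 mul0r.
have K_conicX z : on_conic K z -> on_conic conicX z.
  by move/eqP; rewrite lE mulf_eq0 (negPf l0) => /eqP.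
(* The quadratic regroups as e0 + e1 t + e2 (1 + t^2); divided by 1 + t^2 it becomes a linear
   equation in the point of slope t. [TQ] and [gradE] identify its line as the tangent at P'. *)
pose e0 := mu * nf_sy - q * nf_sx + mu * nu * v * (1 + p * q).
pose e1 := nf_sx - mu * nf_sx - mu * nu * v * (p - q).
pose e2 := mu * v * (nu - 1).
have tangent_line z z' : on_conic nf_W z -> on_conic K z -> z <> nf_P -> z <> nf_X ->
    on_conic std_circle z' -> collinear nf_X z z' -> z' <> nf_X ->
    e0 * z'.1 + e1 * z'.2 + e2 = 0.
  move=> Wz Kz zP zX Oz' cz z'X.
  have linz := nf_lin_on_conicX Wz (K_conicX _ Kz) zP zX.
  (* The point D has no slope parameter; were z' = D, then z would lie on line DX and hence be P or
     X. *)
  have [t tE] : exists t, z' = ray_pt 1 t.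
    apply: std_circleP => // z'0; rewrite z'0 in cz.
    have /eqP : (z.2 - p * z.1) / (1 + p ^+ 2) = 0.
      rewrite -cz /cross /vsub /nf_X /ray_pt /=; field; exact: add1sqr_neq0.
    rewrite mulf_eq0 invr_eq0 (negPf (add1sqr_neq0 _)) orbF subr_eq0.
    by move=> /eqP /(nf_W_secant Wz)[].
  rewrite tE in cz z'X *; have := second_intersection_quadratic Wz linz zX cz z'X => F0.
  apply: (mulIf (add1sqr_neq0 t)); rewrite mul0r -[RHS]F0.
  rewrite /e0 /e1 /e2 /nf_sx /nf_sy /nf_tau /mu /nu /p /q /=; field.
  exact: add1sqr_neq0.
have T1 := tangent_line _ _ WZ1 KZ1 Z1P Z1X OZ1 cZ1 Z1'X.
have T2 := tangent_line _ _ WZ2 KZ2 Z2P Z2X OZ2 cZ2 Z2'X.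
have TQ : e0 * nf_Q.1 + e1 * nf_Q.2 + e2 = 0.
  rewrite /e0 /e1 /e2 /nf_sx /nf_sy /nf_Q /= /mu /nu /p /q; field.
  by rewrite u0 th0 add1sqr_neq0.
have gradE : cgrad nf_K nf_Q =
    (e0 / (mu * nu * (1 + q ^+ 2)), e1 / (mu * nu * (1 + q ^+ 2))).
  rewrite /cgrad /nf_K /nf_Q /e0 /e1 /nf_sx /nf_sy /nf_tau /= /mu /nu /p /q.
  by congr (_, _); field; rewrite u0 v0 th0 add1sqr_neq0.
have c0 : mu * nu * (1 + q ^+ 2) != 0.
  by rewrite !mulf_neq0 ?mu_neq0 ?nu_neq0 ?add1sqr_neq0.
(* Otherwise [TQ] forces e2 = 0, hence nu = 1, which would put P' on Om. *)
have e01 : (e0, e1) != (0, 0).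
  apply/eqP => -[e00 e10]; move: TQ; rewrite e00 e10 !mul0r !add0r.
  by apply/eqP; rewrite !mulf_neq0 ?mu_neq0 // subr_eq0.
split=> //.
- have dot0 (a b : R * R) : e0 * a.1 + e1 * a.2 + e2 = 0 ->
      e0 * b.1 + e1 * b.2 + e2 = 0 -> dot (e0, e1) (vsub a b) = 0.
    by rewrite /dot /vsub /=; lra.
  exact: (cross_eq0_orthogonal e01 (dot0 _ _ T2 T1) (dot0 _ _ TQ T1)).
- exact: nf_Q_on_K.
- rewrite gradE xpair_eqE !mulf_eq0 invr_eq0 (negPf c0) !orbF.
  by move: e01; rewrite xpair_eqE.
- rewrite gradE /dot /vsub /= !(mulrAC _ _^-1) -mulrDl.
  have -> : e0 * (Z2'.1 - Z1'.1) + e1 * (Z2'.2 - Z1'.2) = 0 by lra.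
  by rewrite mul0r.
Qed.

End Normalized.

(** * Reduction to the normal form *)

Section Normalization.
Variable R : realFieldType.
Implicit Types (A B C P Q X Y Z : R * R) (K W : conic R).

Lemma ray_ptP P (p : R) :
  collinear (0, 0) P (ray_pt 1 p) -> P <> (0, 0) ->
  exists2 m, m != 0 & P = ray_pt m p.
Proof.
case: P => x y; rewrite /collinear /cross /vsub /= !subr0 => col P0.
have yE : y = p * x.
  apply/eqP; rewrite -subr_eq0; apply/eqP.
  have p0 := add1sqr_neq0 p.
  transitivity (- (x * (p / (1 * (1 + p ^+ 2))) - y * (1 / (1 * (1 + p ^+ 2))))
    * (1 + p ^+ 2)); first by field; exact: p0.
  by rewrite col oppr0 mul0r.
have x0 : x != 0 by apply/eqP => x0; apply: P0; rewrite yE x0 mulr0.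
exists (x * (1 + p ^+ 2))^-1; first by rewrite invr_eq0 mulf_neq0 ?add1sqr_neq0.
by rewrite yE /ray_pt; congr (_, _); field; rewrite x0 add1sqr_neq0.
Qed.

(* With A = 1 / (1 - i a) etc. and S = (1 - i a) (1 - i b) (1 - i c), the
   condition reads Im (S P Q) - Im (S (P + Q)) - (a + b + c) = a (Re (S P Q) - 1);
   it is affine in a, so that two of the three conditions force both sides to
   vanish. *)
Lemma isogonal_at_ray (a b c : R) P Q :
  let sx := 1 - (a * b + b * c + c * a) in
  let sy := a + b + c - a * b * c in
  a != b -> a != c ->
  isogonal_at (ray_pt 1 a) (ray_pt 1 b) (ray_pt 1 c) P Q ->
  sx * (cmul P Q).2 - sy * (cmul P Q).1
  - (sx * (P.2 + Q.2) - sy * (P.1 + Q.1)) - (a + b + c)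
  = a * (sx * (cmul P Q).1 + sy * (cmul P Q).2 - 1).
Proof.
move=> sx sy ab ac; rewrite /isogonal_at => h.
have d0 : (a - b) * (a - c) != 0 by rewrite mulf_neq0 ?subr_eq0.
apply/eqP; rewrite -subr_eq0; apply/eqP; apply: (mulfI d0); rewrite mulr0.
transitivity (cross (cmul (vsub P (ray_pt 1 a)) (vsub Q (ray_pt 1 a)))
   (cmul (vsub (ray_pt 1 b) (ray_pt 1 a)) (vsub (ray_pt 1 c) (ray_pt 1 a))) *
   ((1 + a ^+ 2) ^+ 2 * (1 + b ^+ 2) * (1 + c ^+ 2))); last by rewrite h mul0r.
rewrite /sx /sy /cross /cmul /vsub /ray_pt /=; field.
by rewrite !add1sqr_neq0.
Qed.

Lemma isogonal_rays (a b c : R) P Q :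
  let sx := 1 - (a * b + b * c + c * a) in
  let sy := a + b + c - a * b * c in
  a != b -> a != c -> b != c ->
  isogonal_at (ray_pt 1 a) (ray_pt 1 b) (ray_pt 1 c) P Q ->
  isogonal_at (ray_pt 1 b) (ray_pt 1 c) (ray_pt 1 a) P Q ->
  sx * (cmul P Q).1 + sy * (cmul P Q).2 = 1 /\
  sx * (cmul P Q).2 - sy * (cmul P Q).1 =
    sx * (P.2 + Q.2) - sy * (P.1 + Q.1) + (a + b + c).
Proof.
move=> sx sy ab ac bc /(isogonal_at_ray ab ac) /=.
have ba : b != a by rewrite eq_sym.
move=> h1 /(isogonal_at_ray bc ba) /=.
have -> : b * c + c * a + a * b = a * b + b * c + c * a by ring.
have -> : b + c + a = a + b + c by ring.
have -> : b * c * a = a * b * c by ring.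
rewrite h1 -/sx -/sy; move/eqP; rewrite -subr_eq0 -mulrBl mulf_eq0 subr_eq0.
rewrite (negPf ab) subr_eq0 /= => /eqP e1; split=> //.
by move: h1; rewrite -/sx -/sy e1; lra.
Qed.

(** With S = x - i y the first equation makes S P P' = 1 + i k, so S = (1 + i k) / (P P'). Then S P
    = (1 + i k) / P' has imaginary part nu (k - q), and similarly for S P'. *)
Lemma isogonal_solve (s x y p q mu nu : R) :
  let P := ray_pt mu p in let Q := ray_pt nu q in
  mu != 0 -> nu != 0 ->
  x * (cmul P Q).1 + y * (cmul P Q).2 = 1 ->
  x * (cmul P Q).2 - y * (cmul P Q).1 = x * (P.2 + Q.2) - y * (P.1 + Q.1) + s ->
  exists k, [/\ x = mu * nu * (1 - p * q + k * (p + q)),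
    y = mu * nu * (p + q - k * (1 - p * q)) &
    s = k - nu * (k - q) - mu * (k - p)].
Proof.
move=> P Q mu0 nu0 e1 e2; set k := x * (cmul P Q).2 - y * (cmul P Q).1 in e2.
have p2 := add1sqr_neq0 p; have q2 := add1sqr_neq0 q.
have xE : x = mu * nu * (1 - p * q + k * (p + q)).
  have -> : 1 - p * q =
      (x * (cmul P Q).1 + y * (cmul P Q).2) * (1 - p * q) by rewrite e1 mul1r.
  rewrite /k /P /Q /cmul /=; field.
  by rewrite mu0 nu0 p2 q2.
have yE : y = mu * nu * (p + q - k * (1 - p * q)).
  have -> : p + q = (x * (cmul P Q).1 + y * (cmul P Q).2) * (p + q).
    by rewrite e1 mul1r.
  rewrite /k /P /Q /cmul /=; field.
  by rewrite mu0 nu0 p2 q2.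
exists k; split=> //.
have -> : s = k - (x * (P.2 + Q.2) - y * (P.1 + Q.1)) by lra.
rewrite xE yE; move: (k) => k'; rewrite /P /Q /=; field.
by rewrite mu0 nu0 p2 q2.
Qed.

(** Vieta's formulas for a polynomial of degree at most three with three distinct roots, obtained
    from divided differences. *)
Lemma cubic_coef (a b c c0 c1 c2 c3 : R) :
  a != b -> a != c -> b != c ->
  c0 + c1 * a + c2 * a ^+ 2 + c3 * a ^+ 3 = 0 ->
  c0 + c1 * b + c2 * b ^+ 2 + c3 * b ^+ 3 = 0 ->
  c0 + c1 * c + c2 * c ^+ 2 + c3 * c ^+ 3 = 0 ->
  [/\ c2 = - c3 * (a + b + c), c1 = c3 * (a * b + b * c + c * a)
    & c0 = - c3 * (a * b * c)].
Proof.
move=> ab ac bc ha hb hc.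
have divided (x y : R) : x != y -> c0 + c1 * x + c2 * x ^+ 2 + c3 * x ^+ 3 = 0 ->
    c0 + c1 * y + c2 * y ^+ 2 + c3 * y ^+ 3 = 0 ->
    c1 + c2 * (x + y) + c3 * (x ^+ 2 + x * y + y ^+ 2) = 0.
  rewrite -subr_eq0 => xy hx hy; apply: (mulfI xy); rewrite mulr0.
  rewrite -[RHS](subrr 0) -{1}hx -hy; ring.
have h1 := divided _ _ ab ha hb; have h2 := divided _ _ ac ha hc.
have e2 : c2 = - c3 * (a + b + c).
  rewrite -subr_eq0 in bc; apply: (mulfI bc).
  apply/eqP; rewrite -subr_eq0 -[X in _ == X](subrr 0) -{1}h1 -h2; apply/eqP.
  ring.
have e1 : c1 = c3 * (a * b + b * c + c * a).
  have -> : c1 = - c2 * (a + b) - c3 * (a ^+ 2 + a * b + b ^+ 2) by lra.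
  by rewrite e2; ring.
split=> //.
have -> : c0 = - (c1 * a + c2 * a ^+ 2 + c3 * a ^+ 3) by lra.
by rewrite e1 e2; ring.
Qed.

Lemma ceval_ray K (m t : R) : m != 0 ->
  ceval K (ray_pt m t) * (m * (1 + t ^+ 2)) ^+ 2 =
  ca K + cb K * t + cc K * t ^+ 2 + (cd K + ce K * t) * (m * (1 + t ^+ 2))
  + cf K * (m * (1 + t ^+ 2)) ^+ 2.
Proof.
by move=> m0; rewrite /ceval /ray_pt /=; field; rewrite m0 add1sqr_neq0.
Qed.

(** The difference of two normalised circle equations is affine, and it vanishes at three
    non-collinear points. *)
Lemma circle_eqP W W' P Q Z :
  is_circle W -> is_circle W' -> ~ collinear P Q Z ->
  on_conic W P -> on_conic W Q -> on_conic W Z ->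
  on_conic W' P -> on_conic W' Q -> on_conic W' Z -> W = W'.
Proof.
case: W W' P Q Z => [a b c d e f] [a' b' c' d' e' f'] [p1 p2] [q1 q2] [z1 z2].
move=> [/= -> -> ->] [/= -> -> ->] /eqP; rewrite /cross /vsub /= => n0.
rewrite /on_conic /ceval /= => hP hQ hZ hP' hQ' hZ'.
set D := (X in X != 0) in n0.
have gP : (d - d') * p1 + (e - e') * p2 + (f - f') = 0 by lra.
have gQ : (d - d') * q1 + (e - e') * q2 + (f - f') = 0 by lra.
have gZ : (d - d') * z1 + (e - e') * z2 + (f - f') = 0 by lra.
have dE : d - d' = 0.
  apply: (mulfI n0); rewrite mulr0 -[RHS](subrr 0).
  transitivity (((d - d') * q1 + (e - e') * q2 + (f - f')
    - ((d - d') * p1 + (e - e') * p2 + (f - f'))) * (z2 - p2)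
    - ((d - d') * z1 + (e - e') * z2 + (f - f')
    - ((d - d') * p1 + (e - e') * p2 + (f - f'))) * (q2 - p2)).
    by rewrite /D; ring.
  by rewrite gP gQ gZ; ring.
have eE : e - e' = 0.
  apply: (mulfI n0); rewrite mulr0 -[RHS](subrr 0).
  transitivity (((d - d') * z1 + (e - e') * z2 + (f - f')
    - ((d - d') * p1 + (e - e') * p2 + (f - f'))) * (q1 - p1)
    - ((d - d') * q1 + (e - e') * q2 + (f - f')
    - ((d - d') * p1 + (e - e') * p2 + (f - f'))) * (z1 - p1)).
    by rewrite /D; ring.
  by rewrite gP gQ gZ; ring.
have fE : f - f' = 0 by rewrite -gP dE eE; ring.
by move: dE eE fE => /subr0_eq -> /subr0_eq -> /subr0_eq ->.
Qed.

(** The condition [th * u != 1] keeps P' off Om. The conic is determined only up to a scalar,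
    whereas the circle is normalised. *)
Definition normal_form A B C P Q X Y K W (k u v th : R) :=
  [/\ [/\ u != 0, v != 0, th != 0 & th * u != 1],
    [/\ nf_vertex k u v th A, nf_vertex k u v th B & nf_vertex k u v th C],
    [/\ P = nf_P k u v th, Q = nf_Q k u v th, X = nf_X k u & Y = nf_Y k v],
    W = nf_W k u v th
  & exists2 l, l != 0 & forall z, ceval K z = l * ceval (nf_K k u v th) z].

Lemma isogonal_normal_form A B C P Q X Y K W (a b c p q : R) :
  A = ray_pt 1 a -> B = ray_pt 1 b -> C = ray_pt 1 c ->
  X = ray_pt 1 p -> Y = ray_pt 1 q ->
  ~ collinear A B C ->
  ~ collinear P B C -> ~ collinear P C A -> ~ collinear P A B ->
  ~ collinear Q B C -> ~ collinear Q C A -> ~ collinear Q A B ->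
  isogonal_conjugate A B C P Q ->
  nonzero_conic K -> on_conic K A -> on_conic K B -> on_conic K C ->
  on_conic K P -> on_conic K Q -> on_conic K (0, 0) ->
  collinear (0, 0) P X -> collinear (0, 0) Q Y ->
  ~ collinear P X Y ->
  is_circle W -> on_conic W P -> on_conic W X -> on_conic W Y ->
  exists k u v th, normal_form A B C P Q X Y K W k u v th.
Proof.
move=> -> -> -> -> -> nABC nPA nPB nPC nQA nQB nQC [iA iB _].
move=> K0 KA KB KC KP KQ KD colX colY nPXY cW WP WX WY.
have [[ab ac] bc] : (a != b /\ a != c) /\ b != c.
  split; [split|]; apply/eqP => e; apply: nABC;
    by rewrite e /collinear /cross /=; ring.
have pq : p != q.
  apply/eqP => e; apply: nPXY; rewrite e /collinear /cross /=; ring.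
have [reS imS] := isogonal_rays ab ac bc iA iB.
have P0 : P <> (0, 0).
  move=> P0; have /eqP : 1 = 0 :> R by rewrite -reS P0 /cmul /=; ring.
  by rewrite oner_eq0.
have Q0 : Q <> (0, 0).
  move=> Q0; have /eqP : 1 = 0 :> R by rewrite -reS Q0 /cmul /=; ring.
  by rewrite oner_eq0.
have [mu mu0 PE] := ray_ptP colX P0; have [nu nu0 QE] := ray_ptP colY Q0.
subst P Q; clear P0 Q0.
have [k [sxE syE sE]] := isogonal_solve mu0 nu0 reS imS.
have cubicE t : (t - a) * (t - b) * (t - c) = (t - (a + b + c)) * (1 + t ^+ 2)
   - ((1 - (a * b + b * c + c * a)) * t - (a + b + c - a * b * c)) by ring.
have cubicp : (p - a) * (p - b) * (p - c) =
    (1 - mu) * (1 + p ^+ 2) * (nu * (k - q) - (k - p)).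
  by rewrite cubicE sxE syE sE; ring.
have cubicq : (q - a) * (q - b) * (q - c) =
    (1 - nu) * (1 + q ^+ 2) * (mu * (k - p) - (k - q)).
  by rewrite cubicE sxE syE sE; ring.
(* If mu = 1, then P lies on Om and [cubicp] makes it a vertex, hence a point of a sideline. *)
have mu1 : 1 - mu != 0.
  apply/eqP => m1; move: cubicp; rewrite m1 !mul0r => /eqP.
  have m1' : mu = 1 by lra.
  rewrite !mulf_eq0 !subr_eq0 -orbA => /or3P[]/eqP e.
  - by apply: nPC; rewrite m1' e /collinear /cross /=; ring.
  - by apply: nPA; rewrite m1' e /collinear /cross /=; ring.
  - by apply: nPB; rewrite m1' e /collinear /cross /=; ring.
have nu1 : 1 - nu != 0.
  apply/eqP => m1; move: cubicq; rewrite m1 !mul0r => /eqP.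
  have m1' : nu = 1 by lra.
  rewrite !mulf_eq0 !subr_eq0 -orbA => /or3P[]/eqP e.
  - by apply: nQC; rewrite m1' e /collinear /cross /=; ring.
  - by apply: nQA; rewrite m1' e /collinear /cross /=; ring.
  - by apply: nQB; rewrite m1' e /collinear /cross /=; ring.
have f0 : cf K = 0 by move: KD; rewrite /on_conic /ceval /=; lra.
(* As D lies on K, restricting K to Om gives a cubic in t instead of a quartic. It vanishes at a, b,
   c, so [cubic_coef] leaves only [cd K] and [ce K] free. *)
have cubicK t : on_conic K (ray_pt 1 t) ->
    ca K + cd K + (cb K + ce K) * t + (cc K + cd K) * t ^+ 2 + ce K * t ^+ 3 = 0.
  move=> h; have := ceval_ray K t (oner_neq0 R).
  by rewrite h mul0r f0 => ->; ring.
have [K2 K1 KZ] := cubic_coef ab ac bc (cubicK a KA) (cubicK b KB) (cubicK c KC).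
have caE : ca K = - ce K * (a * b * c) - cd K by clear -KZ; lra.
have cbE : cb K = ce K * (a * b + b * c + c * a) - ce K by clear -K1; lra.
have ccE : cc K = - ce K * (a + b + c) - cd K by clear -K2; lra.
have K_ray m t : m != 0 -> on_conic K (ray_pt m t) ->
   ce K * ((t - a) * (t - b) * (t - c)) = (1 - m) * (1 + t ^+ 2) * (cd K + ce K * t).
  move=> m0 h; have := ceval_ray K t m0; rewrite h mul0r f0.
  by rewrite caE cbE ccE => {}h; clear -h; lra.
have cancel_m (m t x : R) : 1 - m != 0 ->
    ce K * ((1 - m) * (1 + t ^+ 2) * x) = (1 - m) * (1 + t ^+ 2) * (cd K + ce K * t) ->
    cd K = ce K * (x - t).
  move=> m1 h; have n0 : (1 - m) * (1 + t ^+ 2) != 0 by rewrite mulf_neq0 ?add1sqr_neq0.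
  by apply: (mulfI n0); clear -h; lra.
(* P and P' each express [cd K] through [ce K]; comparing the two gives [tauE]. *)
have dp := cancel_m _ _ _ mu1 (etrans (congr1 _ (esym cubicp)) (K_ray mu p mu0 KP)).
have dq := cancel_m _ _ _ nu1 (etrans (congr1 _ (esym cubicq)) (K_ray nu q nu0 KQ)).
have e0 : ce K != 0.
  apply/eqP => e0; apply: K0; rewrite e0 !mul0r in dp.
  by rewrite caE cbE ccE dp e0; split; split=> //; ring.
have tauE : nu * (k - q) = mu * (k - p).
  by apply: (mulfI e0); clear -dp dq; lra.
have sumE : a + b + c = k - 2 * (nu * (k - q)) by clear -tauE sE; lra.
have u0 : k - p != 0.
  apply/eqP => u0; have /eqP := tauE; rewrite u0 mulr0 mulf_eq0 (negPf nu0) /=.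
  by rewrite subr_eq0 => /eqP v0; move: u0; rewrite v0 => /subr0_eq e;
    rewrite e eqxx in pq.
have v0 : k - q != 0.
  apply/eqP => v0; have /eqP := tauE; rewrite v0 mulr0 eq_sym mulf_eq0 (negPf mu0).
  by rewrite (negPf u0).
exists k, (k - p), (k - q), (mu / (k - q)).
have th0 : mu / (k - q) != 0 by rewrite mulf_neq0 ?invr_eq0.
have thv : mu / (k - q) * (k - q) = mu by rewrite divfK.
have thu : mu / (k - q) * (k - p) = nu.
  by rewrite mulrAC -tauE mulfK.
have up : k - (k - p) = p by ring.
have vq : k - (k - q) = q by ring.
have tau_eq : nf_tau (k - p) (k - q) (mu / (k - q)) = nu * (k - q).
  by rewrite /nf_tau thu.
have sx_eq : nf_sx k (k - p) (k - q) (mu / (k - q)) = 1 - (a * b + b * c + c * a).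
  by rewrite /nf_sx thv thu up vq sxE.
have sy_eq : nf_sy k (k - p) (k - q) (mu / (k - q)) = a + b + c - a * b * c.
  by rewrite /nf_sy thv thu up vq syE.
have base t : (t - a) * (t - b) * (t - c) = 0 ->
    nf_vertex k (k - p) (k - q) (mu / (k - q)) (ray_pt 1 t).
  move=> ct; exists t; split=> //; rewrite /nf_lin sx_eq sy_eq tau_eq.
  rewrite -sumE.
  apply: (mulIf (add1sqr_neq0 t)).
  have -> : (t - (a + b + c)) * (1 + t ^+ 2) =
    (1 - (a * b + b * c + c * a)) * t - (a + b + c - a * b * c).
    by apply/eqP; rewrite -subr_eq0 -cubicE ct.
  by rewrite /ray_pt /=; field; exact: add1sqr_neq0.
split.
- by split=> //; rewrite thu; apply/eqP => e; move: nu1; rewrite e subrr eqxx.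
- by split; apply: base; ring.
- by rewrite /nf_P /nf_Q /nf_X /nf_Y thu thv up vq.
- have PE : ray_pt mu p = nf_P k (k - p) (k - q) (mu / (k - q)) by rewrite /nf_P thv up.
  have XE : ray_pt 1 p = nf_X k (k - p) by rewrite /nf_X up.
  have YE : ray_pt 1 q = nf_Y k (k - q) by rewrite /nf_Y vq.
  apply: (circle_eqP cW _ nPXY) => //; rewrite ?PE ?XE ?YE.
  + exact: nf_P_on_W.
  + exact: nf_X_on_W.
  + exact: nf_Y_on_W.
- exists (ce K) => // z.
  rewrite /ceval /= sx_eq sy_eq tau_eq f0.
  have cdE : cd K = ce K * (nu * (k - q) - k) by rewrite dp; ring.
  by rewrite caE cbE ccE cdE sumE; ring.
Qed.

End Normalization.

(** * Similarities *)

Section Similarity.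
Variable R : realFieldType.
Implicit Types (A B C P Q X Y Z : R * R) (K W : conic R).

Lemma nf_lin_collinear (k u v th : R) Z :
  u != 0 -> v != 0 -> th != 0 -> nf_P k u v th <> nf_Q k u v th ->
  collinear (nf_P k u v th) (nf_Q k u v th) Z -> nf_lin k u v th Z = nf_tau u v th.
Proof.
move=> u0 v0 th0 PQ col; have lP := nf_lin_P k u v0 th0.
have lQ := nf_lin_Q k v u0 th0; move: PQ col lP lQ.
case: (nf_P k u v th) (nf_Q k u v th) Z => [p1 p2] [q1 q2] [z1 z2] PQ col lP lQ.
have n0 : (p2 - q2, q1 - p1) != (0, 0).
  by apply/eqP => -[e1 e2]; apply: PQ; congr (_, _); move: e1 e2 => /=; lra.
have := @cross_eq0_orthogonal R _ (z1 - p1, z2 - p2)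
  (nf_sx k u v th, nf_sy k u v th) n0.
move: col lP lQ; rewrite /collinear /cross /vsub /dot /nf_lin /= => col lP lQ h.
by have := h ltac:(lra) ltac:(lra); lra.
Qed.

Lemma line_tangent_at_scale K K' U V P (l : R) :
  l != 0 -> (forall z, ceval K z = l * ceval K' z) ->
  line_tangent_at U V K' P -> line_tangent_at U V K P.
Proof.
move=> l0 KE [UV col KP g0 d0]; split=> //.
- by rewrite /on_conic KE KP mulr0.
- move: g0; rewrite (cgrad_scale KE); case: (cgrad K' P) => x y.
  by rewrite !xpair_eqE !mulf_eq0 (negPf l0).
- rewrite (cgrad_scale KE); move: d0; case: (cgrad K' P) => x y.
  by rewrite /dot /= -!mulrA -mulrDr => ->; rewrite mulr0.
Qed.

Variables D s : R * R.
Hypothesis s0 : s != (0, 0).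

Let n := s.1 ^+ 2 + s.2 ^+ 2.

Lemma sqnorm_neq0 : n != 0.
Proof.
move: s0; rewrite /n; case: s => x y; rewrite xpair_eqE => /=.
by apply: contra; rewrite paddr_eq0 ?sqr_ge0 // !sqrf_eq0.
Qed.

Definition sim Z := (D.1 + s.1 * Z.1 - s.2 * Z.2, D.2 + s.1 * Z.2 + s.2 * Z.1).

(** The equation of K composed with [sim], the complex map z |-> D + s z. Dividing by |s|^2 keeps
    circles normalised. *)
Definition pullback K : conic R := Conic
  ((ca K * s.1 ^+ 2 + cb K * s.1 * s.2 + cc K * s.2 ^+ 2) / n)
  ((2 * (cc K - ca K) * s.1 * s.2 + cb K * (s.1 ^+ 2 - s.2 ^+ 2)) / n)
  ((ca K * s.2 ^+ 2 - cb K * s.1 * s.2 + cc K * s.1 ^+ 2) / n)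
  (((cgrad K D).1 * s.1 + (cgrad K D).2 * s.2) / n)
  (((cgrad K D).2 * s.1 - (cgrad K D).1 * s.2) / n)
  (ceval K D / n).

Lemma ceval_sim K Z : ceval K (sim Z) = n * ceval (pullback K) Z.
Proof.
rewrite /pullback /sim /ceval /cgrad /ceval /=; have n0 := sqnorm_neq0.
by field.
Qed.

Lemma cgrad_sim K Z : cgrad (pullback K) Z =
  (((cgrad K (sim Z)).1 * s.1 + (cgrad K (sim Z)).2 * s.2) / n,
   ((cgrad K (sim Z)).2 * s.1 - (cgrad K (sim Z)).1 * s.2) / n).
Proof. by rewrite /cgrad /=; congr (_, _); field; exact: sqnorm_neq0. Qed.

Lemma sim_surj Z : exists z, Z = sim z.
Proof.
exists (((Z.1 - D.1) * s.1 + (Z.2 - D.2) * s.2) / n,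
  ((Z.2 - D.2) * s.1 - (Z.1 - D.1) * s.2) / n).
have n0 := sqnorm_neq0.
by case: Z => x y; rewrite /sim /n /=; congr (_, _); field; exact: n0.
Qed.

Lemma on_conic_sim K Z : on_conic K (sim Z) <-> on_conic (pullback K) Z.
Proof.
rewrite /on_conic ceval_sim; split=> [/eqP|->]; last by rewrite mulr0.
by rewrite mulf_eq0 (negPf sqnorm_neq0) => /eqP.
Qed.

Lemma sim_eq Y Z : sim Y = sim Z <-> Y = Z.
Proof.
split=> [|-> //]; case: Y Z => [x y] [x' y'] [/= e1 e2].
have n0 := sqnorm_neq0.
have f1 : s.1 * (x - x') = s.2 * (y - y') by lra.
have f2 : s.1 * (y - y') = - (s.2 * (x - x')) by lra.
congr (_, _); apply/eqP; rewrite -subr_eq0; apply/eqP; apply: (mulfI n0);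
  rewrite mulr0 /n.
  have -> : (s.1 ^+ 2 + s.2 ^+ 2) * (x - x') =
    s.1 * (s.1 * (x - x')) + s.2 * (s.2 * (x - x')) by ring.
  have -> : s.2 * (x - x') = - (s.1 * (y - y')) by lra.
  by rewrite f1; ring.
have -> : (s.1 ^+ 2 + s.2 ^+ 2) * (y - y') =
  s.1 * (s.1 * (y - y')) + s.2 * (s.2 * (y - y')) by ring.
by rewrite -f1 f2; ring.
Qed.

Lemma collinear_sim P Q Z :
  collinear (sim P) (sim Q) (sim Z) <-> collinear P Q Z.
Proof.
rewrite /collinear.
have -> : cross (vsub (sim Q) (sim P)) (vsub (sim Z) (sim P)) =
   n * cross (vsub Q P) (vsub Z P) by rewrite /n /cross /=; ring.
split=> [/eqP|->]; last by rewrite mulr0.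
by rewrite mulf_eq0 (negPf sqnorm_neq0) => /eqP.
Qed.

Lemma isogonal_at_sim A B C P Q :
  isogonal_at (sim A) (sim B) (sim C) (sim P) (sim Q) <-> isogonal_at A B C P Q.
Proof.
rewrite /isogonal_at; set c := (X in _ <-> X = 0).
have -> : cross (cmul (vsub (sim P) (sim A)) (vsub (sim Q) (sim A)))
  (cmul (vsub (sim B) (sim A)) (vsub (sim C) (sim A))) = n ^+ 2 * c.
  by rewrite /n /c /cross /=; ring.
split=> [/eqP|->]; last by rewrite mulr0.
by rewrite mulf_eq0 sqrf_eq0 (negPf sqnorm_neq0) => /eqP.
Qed.

Lemma nonzero_conic_pullback K : nonzero_conic K -> nonzero_conic (pullback K).
Proof.
move=> K0 [[h1 h2 h3] [h4 h5 h6]]; apply: K0; apply: ceval0_coef => Z.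
have [z ->] := sim_surj Z.
by rewrite ceval_sim /ceval h1 h2 h3 h4 h5 h6; ring.
Qed.

Lemma is_circle_pullback W : is_circle W -> is_circle (pullback W).
Proof.
case: W => [a b c d e f] [/= -> -> ->]; have n0 := sqnorm_neq0.
by split=> /=; move: n0; rewrite /n => n0; field.
Qed.

Lemma cgrad_sim_eq0 K Z : cgrad (pullback K) Z != (0, 0) -> cgrad K (sim Z) != (0, 0).
Proof.
by apply: contraNneq => g0; rewrite cgrad_sim g0 !mul0r subr0 addr0 !mul0r.
Qed.

Lemma tangent_at_sim W K Z :
  tangent_at (pullback W) (pullback K) Z -> tangent_at W K (sim Z).
Proof.
move=> [/on_conic_sim h1 /on_conic_sim h2 /cgrad_sim_eq0 h3 /cgrad_sim_eq0 h4 h5].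
split=> //; move: h5; rewrite !cgrad_sim.
case: (cgrad W _) (cgrad K _) => [x y] [x' y']; rewrite /cross /=.
have n0 := sqnorm_neq0.
have -> : (x * s.1 + y * s.2) / n * ((y' * s.1 - x' * s.2) / n)
  - (y * s.1 - x * s.2) / n * ((x' * s.1 + y' * s.2) / n)
  = (x * y' - y * x') / n by rewrite /n; field.
by move/eqP; rewrite mulf_eq0 invr_eq0 (negPf n0) orbF => /eqP.
Qed.

Lemma line_tangent_at_sim U V K Z :
  line_tangent_at U V (pullback K) Z -> line_tangent_at (sim U) (sim V) K (sim Z).
Proof.
move=> [UV /collinear_sim h1 /on_conic_sim h2 /cgrad_sim_eq0 h3 h4].
split=> //; first by rewrite sim_eq.
move: h4; rewrite cgrad_sim; case: (cgrad K _) => [x y].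
rewrite /dot /vsub /sim /= => h4.
have n0 := sqnorm_neq0.
transitivity (n * ((x * s.1 + y * s.2) / n * (V.1 - U.1)
  + (y * s.1 - x * s.2) / n * (V.2 - U.2))); first by field.
by rewrite h4 mulr0.
Qed.

Lemma sim0 : sim (0, 0) = D.
Proof. by rewrite /sim /= !mulr0 !addr0 subr0; case: D. Qed.

End Similarity.

(** Minus the gradient at D is the vector from D to its antipode on the circle, so [sim] sends (0,
    0) and (1, 0) to the ends of a diameter. *)
Lemma circle_pullback (R : realFieldType) (W : conic R) D :
  let s := (- (cgrad W D).1, - (cgrad W D).2) in
  s != (0, 0) -> is_circle W -> on_conic W D ->
  pullback D s W = std_circle R.
Proof.
move=> s s0 [W1 W2 W3]; have := sqnorm_neq0 s0; rewrite /on_conic /pullback => + ->.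
rewrite /s /= W1 W2 W3 => n0; rewrite /std_circle; move: n0.
move: (2 * 1 * D.1 + 0 * D.2 + cd W) (0 * D.1 + 2 * 1 * D.2 + ce W) => x y.
by rewrite !sqrrN => n0; congr Conic; field.
Qed.

(** * Transfer from the normal form to an arbitrary triangle *)

Theorem theorem1p2 (R : realFieldType) (A B C P P' D X Y Z : R * R)
    (Om K W : conic R) :
  (* triangle ABC with circumcircle Om *)
  ~ collinear A B C ->
  is_circle Om -> on_conic Om A -> on_conic Om B -> on_conic Om C ->
  (* P has an (affine) isogonal conjugate P' ; neither lies on a sideline *)
  ~ collinear P B C -> ~ collinear P C A -> ~ collinear P A B ->
  ~ collinear P' B C -> ~ collinear P' C A -> ~ collinear P' A B ->
  P <> P' ->
  isogonal_conjugate A B C P P' ->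
  (* K = the conic (ABCPP') *)
  nonzero_conic K ->
  on_conic K A -> on_conic K B -> on_conic K C -> on_conic K P -> on_conic K P' ->
  (* D = fourth intersection of Om and K *)
  on_conic Om D -> on_conic K D -> D <> A -> D <> B -> D <> C ->
  (* X, Y = second intersections of DP, DP' with Om *)
  on_conic Om X -> collinear D P X -> X <> D ->
  on_conic Om Y -> collinear D P' Y -> Y <> D ->
  (* W = the circle (PXY) *)
  ~ collinear P X Y ->
  is_circle W -> on_conic W P -> on_conic W X -> on_conic W Y ->
  (* Z = second intersection of W with line PP' *)
  on_conic W Z -> collinear P P' Z -> Z <> P ->
  (* (a) *)
  (Z <> A -> Z <> B -> Z <> C ->
   forall K2 : conic R, nonzero_conic K2 ->
     on_conic K2 A -> on_conic K2 B -> on_conic K2 C -> on_conic K2 P ->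
     on_conic K2 Z ->
     tangent_at W K2 P /\ tangent_at W K2 Z) /\
  (* (b) *)
  (X <> A -> X <> B -> X <> C ->
   forall (K3 : conic R) (Z1 Z2 Z1' Z2' : R * R), nonzero_conic K3 ->
     on_conic K3 A -> on_conic K3 B -> on_conic K3 C -> on_conic K3 P ->
     on_conic K3 X ->
     on_conic W Z1 -> on_conic K3 Z1 -> Z1 <> P -> Z1 <> X ->
     on_conic W Z2 -> on_conic K3 Z2 -> Z2 <> P -> Z2 <> X ->
     Z1 <> Z2 ->
     on_conic Om Z1' -> collinear X Z1 Z1' -> Z1' <> X ->
     on_conic Om Z2' -> collinear X Z2 Z2' -> Z2' <> X ->
     Z1' <> Z2' ->
     line_tangent_at Z1' Z2' K P').
Proof.
move=> nABC cOm OmA OmB OmC nPA nPB nPC nQA nQB nQC PQ isoPQ K0 KA KB KC KP KQ.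
move=> OmD KD DA DB DC OmX colX XD OmY colY YD nPXY cW WP WX WY WZ colZ ZP.
pose s := (- (cgrad Om D).1, - (cgrad Om D).2).
have s0 : s != (0, 0).
  have := circle_cgrad_neq0 cOm OmD OmA DA.
  by rewrite /s; case: (cgrad Om D) => x y; rewrite !xpair_eqE !oppr_eq0.
have OmE := circle_pullback s0 cOm OmD.
have onE := on_conic_sim D s0; have eqE := sim_eq D s0.
have colE := collinear_sim D s0; have isoE := isogonal_at_sim D s0.
have DE := sim0 D s.
have on_Om z : on_conic Om (sim D s z) -> on_conic (std_circle R) z.
  by move/onE; rewrite OmE.
have on_Om_ray z : on_conic Om (sim D s z) -> sim D s z <> D ->
    exists t, z = ray_pt 1 t.
  move=> /on_Om h zD; apply: std_circleP h _ => z0; apply: zD.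
  by rewrite z0 sim0.
have surj := sim_surj D s0.
case: (surj A) (surj B) (surj C) => [a aE] [b bE] [c cE].
case: (surj P) (surj P') (surj X) => [p pE] [q qE] [x xE].
case: (surj Y) (surj Z) => [y yE] [z zE]; subst A B C P P' X Y Z.
have [ta aE] := on_Om_ray _ OmA (nesym DA).
have [tb bE] := on_Om_ray _ OmB (nesym DB).
have [tc cE] := on_Om_ray _ OmC (nesym DC).
have [tx xE] := on_Om_ray _ OmX XD.
have [ty yE] := on_Om_ray _ OmY YD.
rewrite -{1}DE in colX; rewrite -{1}DE in colY; rewrite -DE in KD.
(* Every incidence is pulled back along [sim], with D becoming the origin. *)
rewrite -> !colE in *; rewrite -> !onE in *; rewrite -> !eqE in *.
have iso : isogonal_conjugate a b c p q by case: isoPQ => /isoE ? /isoE ? /isoE.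
have [k [u [v [th nf]]]] := isogonal_normal_form aE bE cE xE yE nABC nPA nPB nPC
  nQA nQB nQC iso (nonzero_conic_pullback s0 K0) KA KB KC KP KQ KD colX colY nPXY
  (is_circle_pullback D s0 cW) WP WX WY.
case: nf => -[u0 v0 th0 nu1] [baseA baseB baseC] [pE qE xE' yE'] WE [l l0 KE].
clear xE yE; subst p q x; rewrite WE in WZ.
have lZ : nf_lin k u v th z = nf_tau u v th.
  by apply: nf_lin_collinear colZ.
split=> [ZA ZB ZC K2 K20|XA XB XC K3 Z1 Z2 Z1' Z2' K30].
  rewrite !onE => K2A K2B K2C K2P K2Z.
  have [t1 t2] := circle_tangent_conicZ u0 v0 th0 nABC baseA baseB baseC nPA nPB nPC
    WZ lZ ZP ZA ZB ZC (nonzero_conic_pullback s0 K20) K2A K2B K2C K2P K2Z.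
  by split; apply: (tangent_at_sim s0); rewrite WE.
case: (surj Z1) (surj Z2) (surj Z1') (surj Z2') => [z1 ->] [z2 ->] [z1' ->] [z2' ->].
rewrite !onE !eqE !colE OmE WE => K3A K3B K3C K3P K3X WZ1 KZ1 Z1P Z1X WZ2 KZ2 Z2P Z2X.
move=> _ OZ1 cZ1 Z1X' OZ2 cZ2 Z2X' Z12.
have XP : nf_X k u <> nf_P k u v th.
  by move=> XP; apply: nPXY; rewrite -XP /collinear /cross /=; ring.
apply: (line_tangent_at_sim s0); apply: (line_tangent_at_scale l0 KE).
exact: (chord_tangent_K u0 v0 th0 nABC baseA baseB baseC nu1 nPA nPB nPC XP XA XB XC
  (nonzero_conic_pullback s0 K30) K3A K3B K3C K3P K3X WZ1 KZ1 Z1P Z1X WZ2 KZ2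
  Z2P Z2X OZ1 cZ1 Z1X' OZ2 cZ2 Z2X' Z12).
Qed.
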